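(* Let $A$ be an associative algebra over a field $K$ and let $r,s\in A\otimes A$, identified with linear maps from $A^*$ to $A$. If $r$ and $s$ are skew-symmetric, then $(A,A^*,r,s)$ is an $\mathcal{O}$-operator system associated to $(A^*,\bullet_\ell,\bullet_r)$ if and only if $(A,\delta_r,\delta_s,\Delta)$ is a quasitriangular covariant bialgebra, where for all $a\in A$, $$\delta_r(a)=a r^1\otimes r^2-r^1\otimes r^2a,\quad \delta_s(a)=a s^1\otimes s^2-s^1\otimes s^2a,\quad \Delta(a)=a r^1\otimes r^2-s^1\otimes s^2a.$$
   Context: All vector spaces, linear maps and tensor products are over a field $K$; associative algebras are not assumed to be unital. $A^*$ is the dual space of $A$, with pairing $\langle f,x\rangle=f(x)$. Elements of $A\otimes A$ are written $r=r^1\otimes r^2$ (implicit summation), and $\bar r,\bar s$ denote further copies of $r,s$. $r=r^1\otimes r^2\in A\otimes A$ gives linear maps $r,r^t:A^*\to A$, $r(f)=r^1\langle f,r^2\rangle$, $r^t(f)=\langle f,r^1\rangle r^2$ (similarly $s,s^t$). $r$ is skew-symmetric if $r=-r^t$. Dual bimodule $(A^*,\bullet_\ell,\bullet_r)$: $\langle a\bullet_\ell f,b\rangle=\langle f,ba\rangle$, $\langle f\bullet_r a,b\rangle=\langle f,ab\rangle$ for $a,b\in A$, $f\in A^*$. $\mathcal{O}$-operator system: for an $A$-bimodule $(M,\triangleright,\triangleleft)$ and linear maps $R,S:M\to A$, $(A,M,R,S)$ is an $\mathcal{O}$-operator system associated to $(M,\triangleright,\triangleleft)$ if for all $x,y\in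 M$: $R(x)R(y)=R(R(x)\triangleright y+x\triangleleft S(y))$ and $S(x)S(y)=S(R(x)\triangleright y+x\triangleleft S(y))$. Associative Yang-Baxter pair: $r,s\in A\otimes A$ with $r^1\bar r^1\otimes\bar r^2\otimes r^2-r^1\otimes r^2\bar r^1\otimes\bar r^2+r^1\otimes s^1\otimes s^2r^2=0$ and $s^1r^1\otimes r^2\otimes s^2-s^1\otimes s^2\bar s^1\otimes\bar s^2+s^1\otimes\bar s^1\otimes\bar s^2s^2=0$ in $A\otimes A\otimes A$. Covariant bialgebra $(A,\delta_1,\delta_2,\Delta)$: an associative algebra $A$ with derivations $\delta_1,\delta_2:A\to A\otimes A$ (where $A\otimes A$ is the $A$-bimodule $a(b\otimes c)d=ab\otimes cd$) and a coassociative linear map $\Delta:A\to A\otimes A$ such that $\Delta(ab)=\Delta(a)b+a\delta_1(b)=\delta_2(a)b+a\Delta(b)$ for all $a,b\in A$. For $r,s\in A\otimes A$, with $\delta_r,\delta_s,\Delta$ as in the claim, $(A,\delta_r,\delta_s,\Delta)$ is called a quasitriangular covariant bialgebra if it is a covariant bialgebra and $(r,s)$ is an associative Yang-Baxter pair. *)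

(* Defs.v *)
From HB Require Import structures.
From mathcomp Require Import all_boot all_algebra.
From mathcomp Require Import boolp.
From mathcomp.multinomials Require Import freeg.

Set Implicit Arguments.
Unset Strict Implicit.
Unset Printing Implicit Defensive.

Import GRing.Theory.
Local Open Scope ring_scope.
Local Open Scope quotient_scope.

Notation is_bilinear := (bilinear_for *:%R *:%R).

Section TensorProduct.
Context (K : fieldType) (U V : lmodType K).

Local Notation free := {freeg (U * V)%type / K}.
Local Notation gen u v := (<< (u, v) >> : free).

(* The subspace of the free vector space on U * V by which one divides. *)
Inductive tens_null : free -> Prop :=
| tens_null0 : tens_null 0
| tens_null_lin k p q : tens_null p -> tens_null q -> tens_null (k *: p + q)
| tens_null_addl u u' v : tens_null (gen (u + u') v - gen u v - gen u' v)
| tens_null_addr u v v' : tens_null (gen u (v + v') - gen u v - gen u v')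
| tens_null_scalel k u v : tens_null (gen (k *: u) v - k *: gen u v)
| tens_null_scaler k u v : tens_null (gen u (k *: v) - k *: gen u v).

Lemma tens_nullZ k p : tens_null p -> tens_null (k *: p).
Proof. by move=> np; rewrite -[_ *: p]addr0; apply: tens_null_lin np tens_null0. Qed.

Lemma tens_nullD p q : tens_null p -> tens_null q -> tens_null (p + q).
Proof. by move=> np nq; rewrite -[p]scale1r; apply: tens_null_lin. Qed.

Lemma tens_nullN p : tens_null p -> tens_null (- p).
Proof. by rewrite -scaleN1r; apply: tens_nullZ. Qed.

Definition tens_equiv (p q : free) : bool := `[< tens_null (p - q) >].

Lemma tens_equiv_class : equiv_class_of tens_equiv.
Proof.
split=> [p|p q|q p s].
- by apply/asboolP; rewrite subrr; apply: tens_null0.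
- by apply/asboolP/asboolP => /tens_nullN; rewrite opprB.
- move=> /asboolP n1 /asboolP n2; apply/asboolP.
  by rewrite -(subrK q p) -addrA; apply: tens_nullD.
Qed.

Canonical tens_equivRel := EquivRelPack tens_equiv_class.

Definition tensor := {eq_quot tens_equiv}.
HB.instance Definition _ : EqQuotient _ tens_equiv tensor := EqQuotient.on tensor.
HB.instance Definition _ := Choice.on tensor.

Lemma tensor_eqP (p q : free) :
  \pi_tensor p = \pi_tensor q <-> tens_null (p - q).
Proof. by rewrite (rwP eqP) eqmodE; split => /asboolP. Qed.

Lemma tensor_reprP (p : free) : tens_null (repr (\pi_tensor p) - p).
Proof. by apply/tensor_eqP; rewrite reprK. Qed.

Definition tensor_zero : tensor := \pi_tensor 0.
Definition tensor_opp (t : tensor) : tensor := \pi_tensor (- repr t).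
Definition tensor_add (t t' : tensor) : tensor := \pi_tensor (repr t + repr t').
Definition tensor_scale (k : K) (t : tensor) : tensor :=
  \pi_tensor (k *: repr t).

Lemma pi_tensorN p : \pi_tensor (- p) = tensor_opp (\pi_tensor p).
Proof.
by apply/esym/tensor_eqP; rewrite -opprD; apply/tens_nullN/tensor_reprP.
Qed.

Lemma pi_tensorD p q :
  \pi_tensor (p + q) = tensor_add (\pi_tensor p) (\pi_tensor q).
Proof.
apply/esym/tensor_eqP; rewrite opprD addrACA.
by apply: tens_nullD; apply: tensor_reprP.
Qed.

Lemma pi_tensorZ k p : \pi_tensor (k *: p) = tensor_scale k (\pi_tensor p).
Proof.
by apply/esym/tensor_eqP; rewrite -scalerBr; apply/tens_nullZ/tensor_reprP.
Qed.

Lemma pi_tensor0 : \pi_tensor 0 = tensor_zero. Proof. by []. Qed.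

Lemma tensorW (P : tensor -> Prop) :
  (forall p, P (\pi_tensor p)) -> forall t, P t.
Proof. by move=> Ppi t; rewrite -[t]reprK. Qed.

Fact tensor_addA : associative tensor_add.
Proof.
elim/tensorW=> p; elim/tensorW=> q; elim/tensorW=> s.
by rewrite -(pi_tensorD q) -(pi_tensorD p q) -!pi_tensorD addrA.
Qed.

Fact tensor_addC : commutative tensor_add.
Proof. by elim/tensorW=> p; elim/tensorW=> q; rewrite -!pi_tensorD addrC. Qed.

Fact tensor_add0 : left_id tensor_zero tensor_add.
Proof. by elim/tensorW=> p; rewrite -pi_tensor0 -pi_tensorD add0r. Qed.

Fact tensor_addN : left_inverse tensor_zero tensor_opp tensor_add.
Proof. by elim/tensorW=> p; rewrite -pi_tensorN -pi_tensorD addNr pi_tensor0. Qed.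

HB.instance Definition _ := GRing.isZmodule.Build tensor
  tensor_addA tensor_addC tensor_add0 tensor_addN.

Fact tensor_scaleA a b t :
  tensor_scale a (tensor_scale b t) = tensor_scale (a * b) t.
Proof. by elim/tensorW: t => p; rewrite -!pi_tensorZ scalerA. Qed.

Fact tensor_scale1 : left_id 1 tensor_scale.
Proof. by elim/tensorW=> p; rewrite -pi_tensorZ scale1r. Qed.

Fact tensor_scaleDr : right_distributive tensor_scale +%R.
Proof.
move=> k; elim/tensorW=> p; elim/tensorW=> q.
transitivity (tensor_add (\pi_tensor (k *: p)) (\pi_tensor (k *: q))); last first.
  by rewrite !pi_tensorZ.
by rewrite -pi_tensorD -scalerDr pi_tensorZ pi_tensorD.
Qed.

Fact tensor_scaleDl t : {morph tensor_scale^~ t : a b / a + b}.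
Proof.
move=> a b; elim/tensorW: t => p.
transitivity (tensor_add (\pi_tensor (a *: p)) (\pi_tensor (b *: p))).
  by rewrite -pi_tensorD -scalerDl pi_tensorZ.
by rewrite !pi_tensorZ.
Qed.

HB.instance Definition _ := GRing.Zmodule_isLmodule.Build K tensor
  tensor_scaleA tensor_scale1 tensor_scaleDr tensor_scaleDl.

Lemma pi_tensor_linear : linear (\pi_tensor : free -> tensor).
Proof. by move=> k p q; rewrite pi_tensorD pi_tensorZ. Qed.

Definition tens (u : U) (v : V) : tensor := \pi_tensor (gen u v).

Lemma tens_bilinear : is_bilinear tens.
Proof.
split=> [v k u u'|u k v v'].
- transitivity (\pi_tensor (gen (k *: u) v + gen u' v)).
    by apply/tensor_eqP; rewrite opprD addrA; apply: tens_null_addl.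
  rewrite [RHS](_ : _ = \pi_tensor (k *: gen u v + gen u' v)).
    by apply/tensor_eqP; rewrite opprD addrACA subrr addr0; apply: tens_null_scalel.
  by rewrite pi_tensor_linear.
- transitivity (\pi_tensor (gen u (k *: v) + gen u v')).
    by apply/tensor_eqP; rewrite opprD addrA; apply: tens_null_addr.
  rewrite [RHS](_ : _ = \pi_tensor (k *: gen u v + gen u v')).
    by apply/tensor_eqP; rewrite opprD addrACA subrr addr0; apply: tens_null_scaler.
  by rewrite pi_tensor_linear.
Qed.

HB.instance Definition _ :=
  bilinear_isBilinear.Build K U V tensor *:%R *:%R tens tens_bilinear.

Lemma tensor_ind (P : tensor -> Prop) :
  P 0 -> (forall t t', P t -> P t' -> P (t + t')) -> (forall u v, P (tens u v)) ->
  forall t, P t.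
Proof.
move=> P0 PD Ptens; elim/tensorW=> p; rewrite -[p]freeg_sumE.
elim: (dom p) => [|[u v] s IHs]; first by rewrite big_nil.
rewrite big_cons pi_tensorD; apply: PD => //.
rewrite [X in P X](_ : _ = tens (coeff (u, v) p *: u) v) //.
rewrite linearZl_LR /= -[_ *: tens u v]pi_tensorZ; congr (\pi_tensor _).
by apply/eqP/freeg_eqP=> z; rewrite coeffZ !coeffU mul1r.
Qed.

Section TensorSum.
Context (W : lmodType K).

(* For bilinear f, this is the linear map on the tensor product induced by f
   (tsum_linear, tsum_tens); the value is meaningless for other f. *)
Definition tsum (f : U -> V -> W) (t : tensor) : W :=
  fglift (fun p => f p.1 p.2) (repr t).

Variable f : U -> V -> W.
Hypothesis f_bilin : is_bilinear f.

Let F (p : free) : W := fglift (fun p => f p.1 p.2) p.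

Let FU k u v : F << k *g (u, v) >> = k *: f u v. Proof. exact: liftU. Qed.

Let FB p q : F (p - q) = F p - F q. Proof. exact: lift_is_additive. Qed.

Let F0 : F 0 = 0. Proof. by rewrite -(subrr 0) FB subrr. Qed.

Let FN p : F (- p) = - F p. Proof. by rewrite -sub0r FB F0 sub0r. Qed.

Let FD p q : F (p + q) = F p + F q.
Proof. by rewrite -[q]opprK FB [in RHS]FN. Qed.

Let FZ k p : F (k *: p) = k *: F p.
Proof.
have Fsum (s : seq (U * V)) (G : U * V -> free) :
  F (\sum_(z <- s) G z) = \sum_(z <- s) F (G z).
  by elim: s => [|z s IH]; rewrite ?big_nil ?F0 // !big_cons FD IH.
rewrite [k *: p]/(fgscale k p) Fsum -[p in RHS]freeg_sumE Fsum scaler_sumr.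
by apply: eq_bigr => -[u v] _; rewrite !FU scalerA.
Qed.

Let F_null p : tens_null p -> F p = 0.
Proof.
case: f_bilin => fl fr.
have fDl u u' v : f (u + u') v = f u v + f u' v.
  by have := fl v 1 u u'; rewrite /= !scale1r.
have fDr u v v' : f u (v + v') = f u v + f u v'.
  by have := fr u 1 v v'; rewrite /= !scale1r.
have f0l v : f 0 v = 0 by apply: (addrI (f 0 v)); rewrite -fDl !addr0.
have f0r u : f u 0 = 0 by apply: (addrI (f u 0)); rewrite -fDr !addr0.
have fZl k u v : f (k *: u) v = k *: f u v.
  by have := fl v k u 0; rewrite /= f0l !addr0.
have fZr k u v : f u (k *: v) = k *: f u v.
  by have := fr u k v 0; rewrite /= f0r !addr0.
elim=> [|k {}p q _ Fp _ Fq|u u' v|u v v'|k u v|k u v].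
- exact: F0.
- by rewrite FD FZ Fp Fq scaler0 addr0.
- by rewrite !FB !FU !scale1r fDl -addrA -opprD subrr.
- by rewrite !FB !FU !scale1r fDr -addrA -opprD subrr.
- by rewrite FB FZ !FU !scale1r fZl subrr.
- by rewrite FB FZ !FU !scale1r fZr subrr.
Qed.

Let tsum_pi p : tsum f (\pi_tensor p) = F p.
Proof.
by apply/eqP; rewrite -subr_eq0 -[tsum _ _]/(F _) -FB; apply/eqP/F_null/tensor_reprP.
Qed.

Lemma tsum_linear : linear (tsum f).
Proof.
move=> k; elim/tensorW=> p; elim/tensorW=> q.
by rewrite -pi_tensor_linear !tsum_pi FD FZ.
Qed.

Lemma tsum_tens u v : tsum f (tens u v) = f u v.
Proof. by rewrite tsum_pi FU scale1r. Qed.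

End TensorSum.

End TensorProduct.

Notation "U ⊗ V" := (tensor U V) (at level 40, left associativity) : type_scope.
Notation "u ⊗ v" := (tens u v) (at level 40, left associativity) : ring_scope.

(* Implicit summation: the value, at t = \sum_i x_i ⊗ y_i, of the linear map
   induced by the bilinear expression E(x, y), i.e. \sum_i E(x_i, y_i). *)
Notation "'\tsum_' ( x ⊗ y <- t ) E" := (tsum (fun x y => E) t)
  (at level 41, x name, y name, t at level 39, E at level 41,
   format "'\tsum_' ( x  ⊗  y  <-  t )  E") : ring_scope.

(* Nested implicit sums of multilinear expressions are again meaningful. *)
Lemma tsum_bilinear (K : fieldType) (U V U' V' W : lmodType K)
    (f : U -> V -> U' -> V' -> W) (t : U' ⊗ V') :
  (forall x y, is_bilinear (f x y)) ->
  (forall x' y', is_bilinear (fun x y => f x y x' y')) ->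
  is_bilinear (fun x y => \tsum_(x' ⊗ y' <- t) f x y x' y').
Proof.
move=> f2 f1; have lin x y := tsum_linear (f2 x y).
have tsum0 x y : tsum (f x y) 0 = 0.
  by have := lin x y (-1) 0 0; rewrite scaler0 addr0 scaleN1r addNr.
have tsumD x y u v : tsum (f x y) (u + v) = tsum (f x y) u + tsum (f x y) v.
  by have := lin x y 1 u v; rewrite !scale1r.
split=> [y k x x'|x k y y'] /=; elim/tensor_ind: t => [|t u IHt IHu|u v].
- by rewrite !tsum0 scaler0 addr0.
- by rewrite !tsumD IHt IHu scalerDr addrACA.
- by rewrite !(tsum_tens (f2 _ _)); apply: (f1 u v).1.
- by rewrite !tsum0 scaler0 addr0.
- by rewrite !tsumD IHt IHu scalerDr addrACA.
- by rewrite !(tsum_tens (f2 _ _)); apply: (f1 u v).2.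
Qed.

HB.mixin Record Lmodule_isAssocAlgebra (K : fieldType) A of GRing.Lmodule K A := {
  amul : A -> A -> A;
  amulA : associative amul;
  amul_bilinear : is_bilinear amul
}.

#[short(type="assocAlgType")]
HB.structure Definition AssocAlgebra (K : fieldType) :=
  {A of GRing.Lmodule K A & Lmodule_isAssocAlgebra K A}.

Notation "x ** y" := (amul x y) (at level 40, left associativity) : ring_scope.

HB.instance Definition _ (K : fieldType) (A : assocAlgType K) :=
  bilinear_isBilinear.Build K A A A *:%R *:%R (@amul K A) (@amul_bilinear K A).

Record bimodule (K : fieldType) (A : assocAlgType K) (M : lmodType K) := Bimodule {
  lact : A -> M -> M;
  ract : M -> A -> M;
  lact_bilinear : is_bilinear lact;
  ract_bilinear : is_bilinear ract;
  lactA : forall a b m, lact (a ** b) m = lact a (lact b m);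
  ractA : forall m a b, ract m (a ** b) = ract (ract m a) b;
  lractA : forall a m b, ract (lact a m) b = lact a (ract m b)
}.

Section Dual.
Context (K : fieldType) (V : lmodType K).

Definition dual := {linear V -> K^o}.

Implicit Types f g h : dual.

Lemma dualP f g : (forall x, f x = g x) -> f = g.
Proof.
case: f g => [f [[f1] [f2]]] [g [[g1] [g2]]] /= /funext efg.
case: g / efg in g1 g2 *.
by rewrite (Prop_irrelevance f1 g1) (Prop_irrelevance f2 g2).
Qed.

HB.instance Definition _ := gen_eqMixin dual.
HB.instance Definition _ := gen_choiceMixin dual.

Definition dual_zero : dual := \0.
Definition dual_opp f : dual := \- f.
Definition dual_add f g : dual := f \+ g.
Definition dual_scale (k : K) f : dual := k \*: f.

Fact dual_addA : associative dual_add.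
Proof. by move=> f g h; apply: dualP => x /=; rewrite addrA. Qed.
Fact dual_addC : commutative dual_add.
Proof. by move=> f g; apply: dualP => x /=; rewrite addrC. Qed.
Fact dual_add0 : left_id dual_zero dual_add.
Proof. by move=> f; apply: dualP => x /=; rewrite add0r. Qed.
Fact dual_addN : left_inverse dual_zero dual_opp dual_add.
Proof. by move=> f; apply: dualP => x /=; rewrite addNr. Qed.

HB.instance Definition _ := GRing.isZmodule.Build dual
  dual_addA dual_addC dual_add0 dual_addN.

Fact dual_scaleA a b f : dual_scale a (dual_scale b f) = dual_scale (a * b) f.
Proof. by apply: dualP => x /=; rewrite scalerA. Qed.
Fact dual_scale1 : left_id 1 dual_scale.
Proof. by move=> f; apply: dualP => x /=; rewrite scale1r. Qed.
Fact dual_scaleDr : right_distributive dual_scale +%R.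
Proof. by move=> k f g; apply: dualP => x /=; rewrite scalerDr. Qed.
Fact dual_scaleDl f : {morph dual_scale^~ f : a b / a + b}.
Proof. by move=> a b; apply: dualP => x /=; rewrite scalerDl. Qed.

HB.instance Definition _ := GRing.Zmodule_isLmodule.Build K dual
  dual_scaleA dual_scale1 dual_scaleDr dual_scaleDl.

End Dual.

Definition pairing (K : fieldType) (V : lmodType K) (f : dual V) (x : V) : K := f x.

Notation "⟨ f , x ⟩" := (pairing f x)
  (at level 0, f at level 99, x at level 99, format "⟨ f ,  x ⟩") : ring_scope.

Section Bimodules.
Context (K : fieldType) (A : assocAlgType K).
Implicit Types (a b c d : A) (f : dual A) (t r s : A ⊗ A).

Definition dual_lact_fun a f : A -> K^o := fun b => ⟨f, b ** a⟩.
Definition dual_ract_fun f a : A -> K^o := fun b => ⟨f, a ** b⟩.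

Fact dual_lact_linear a f : linear (dual_lact_fun a f).
Proof. by move=> k b c; rewrite /dual_lact_fun /pairing linearPl linearP. Qed.
Fact dual_ract_linear f a : linear (dual_ract_fun f a).
Proof. by move=> k b c; rewrite /dual_ract_fun /pairing linearPr linearP. Qed.

HB.instance Definition _ a f := GRing.isLinear.Build K A K^o *:%R
  (dual_lact_fun a f) (dual_lact_linear a f).
HB.instance Definition _ f a := GRing.isLinear.Build K A K^o *:%R
  (dual_ract_fun f a) (dual_ract_linear f a).

Definition dual_lact a f : dual A := dual_lact_fun a f.
Definition dual_ract f a : dual A := dual_ract_fun f a.

Fact dual_lact_bilinear : is_bilinear dual_lact.
Proof.
split=> [f k a b|a k f g]; apply: dualP => x //=.
by rewrite /dual_lact_fun /pairing linearPr linearP.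
Qed.

Fact dual_ract_bilinear : is_bilinear dual_ract.
Proof.
split=> [a k f g|f k a b]; apply: dualP => x //=.
by rewrite /dual_ract_fun /pairing linearPl linearP.
Qed.

Fact dual_lactA a b f : dual_lact (a ** b) f = dual_lact a (dual_lact b f).
Proof. by apply: dualP => x; rewrite /= /dual_lact_fun /pairing amulA. Qed.

Fact dual_ractA f a b : dual_ract f (a ** b) = dual_ract (dual_ract f a) b.
Proof. by apply: dualP => x; rewrite /= /dual_ract_fun /pairing amulA. Qed.

Fact dual_lractA a f b :
  dual_ract (dual_lact a f) b = dual_lact a (dual_ract f b).
Proof.
apply: dualP => x.
by rewrite /= /dual_ract_fun /dual_lact_fun /pairing /= /dual_lact_fun /pairing amulA.
Qed.

Definition dual_bimodule : bimodule A (dual A) :=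
  Bimodule dual_lact_bilinear dual_ract_bilinear
           dual_lactA dual_ractA dual_lractA.

Definition tens_lact a t : A ⊗ A := \tsum_(x ⊗ y <- t) (a ** x) ⊗ y.
Definition tens_ract t a : A ⊗ A := \tsum_(x ⊗ y <- t) x ⊗ (y ** a).

Lemma tens_lact_summand a :
  is_bilinear (fun x y => (a ** x) ⊗ y : A ⊗ A).
Proof. by split=> [v k u u'|u k v v'] /=; rewrite !(linearPr, linearPl). Qed.

Lemma tens_ract_summand a :
  is_bilinear (fun x y => x ⊗ (y ** a) : A ⊗ A).
Proof. by split=> [v k u u'|u k v v'] /=; rewrite !(linearPr, linearPl). Qed.

Lemma tens_lact_tens a b c : tens_lact a (b ⊗ c) = (a ** b) ⊗ c.
Proof. exact: tsum_tens (tens_lact_summand a) b c. Qed.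

Lemma tens_ract_tens b c a : tens_ract (b ⊗ c) a = b ⊗ (c ** a).
Proof. exact: tsum_tens (tens_ract_summand a) b c. Qed.

Fact tens_lact_bilinear : is_bilinear tens_lact.
Proof.
split=> [t k a b|a]; last exact: tsum_linear (tens_lact_summand a).
have lin c := tsum_linear (tens_lact_summand c) : linear (tens_lact c).
have lact0 c : tens_lact c 0 = 0.
  by have := lin c (-1) 0 0; rewrite scaler0 addr0 scaleN1r addNr.
have lactD c u v : tens_lact c (u + v) = tens_lact c u + tens_lact c v.
  by have := lin c 1 u v; rewrite !scale1r.
rewrite /=; elim/tensor_ind: t => [|t u IHt IHu|x y].
- by rewrite !lact0 scaler0 addr0.
- by rewrite !lactD IHt IHu scalerDr addrACA.
- by rewrite !tens_lact_tens linearPl /= linearPl.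
Qed.

Fact tens_ract_bilinear : is_bilinear tens_ract.
Proof.
split=> [a|t k a b]; first exact: tsum_linear (tens_ract_summand a).
have lin c := tsum_linear (tens_ract_summand c) : linear (tens_ract^~ c).
have ract0 c : tens_ract 0 c = 0.
  by have := lin c (-1) 0 0; rewrite scaler0 addr0 scaleN1r addNr.
have ractD c u v : tens_ract (u + v) c = tens_ract u c + tens_ract v c.
  by have := lin c 1 u v; rewrite !scale1r.
rewrite /=; elim/tensor_ind: t => [|t u IHt IHu|x y].
- by rewrite !ract0 scaler0 addr0.
- by rewrite !ractD IHt IHu scalerDr addrACA.
- by rewrite !tens_ract_tens linearPr /= linearPr.
Qed.

HB.instance Definition _ := bilinear_isBilinear.Build K A (tensor A A) (tensor A A)
  *:%R *:%R tens_lact tens_lact_bilinear.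
HB.instance Definition _ := bilinear_isBilinear.Build K (tensor A A) A (tensor A A)
  *:%R *:%R tens_ract tens_ract_bilinear.

Fact tens_lactA a b t : tens_lact (a ** b) t = tens_lact a (tens_lact b t).
Proof.
elim/tensor_ind: t => [|t u IHt IHu|x y]; first by rewrite !linear0r.
- by rewrite !linearDr /= IHt IHu.
- by rewrite !tens_lact_tens amulA.
Qed.

Fact tens_ractA t a b : tens_ract t (a ** b) = tens_ract (tens_ract t a) b.
Proof.
elim/tensor_ind: t => [|t u IHt IHu|x y]; first by rewrite !linear0l.
- by rewrite !linearDl /= IHt IHu.
- by rewrite !tens_ract_tens amulA.
Qed.

Fact tens_lractA a t b : tens_ract (tens_lact a t) b = tens_lact a (tens_ract t b).
Proof.
elim/tensor_ind: t => [|t u IHt IHu|x y].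
- by rewrite linear0r !linear0l linear0r.
- by rewrite linearDr !linearDl linearDr /= IHt IHu.
- by rewrite tens_lact_tens !tens_ract_tens tens_lact_tens.
Qed.

Definition tens_bimodule : bimodule A (tensor A A) :=
  Bimodule tens_lact_bilinear tens_ract_bilinear
           tens_lactA tens_ractA tens_lractA.

End Bimodules.

Section Definitions.
Context (K : fieldType) (A : assocAlgType K).
Implicit Types (a b : A) (f : dual A) (r s : A ⊗ A).

Definition tens_map r f : A := \tsum_(x ⊗ y <- r) (⟨f, y⟩ *: x).
Definition tens_map_tr r f : A := \tsum_(x ⊗ y <- r) (⟨f, x⟩ *: y).

Lemma tens_map_summand f : is_bilinear (fun x y => ⟨f, y⟩ *: x : A).
Proof.
split=> [y k x x'|x k y y'] /=; rewrite /pairing.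
- by rewrite scalerDr !scalerA mulrC.
- by rewrite linearP scalerDl -scalerA.
Qed.

Lemma tens_map_tr_summand f : is_bilinear (fun x y => ⟨f, x⟩ *: y : A).
Proof. by have [l r] := tens_map_summand f; split=> [y|x]; [exact: r|exact: l]. Qed.

Fact tens_map_linear r : linear (tens_map r).
Proof.
have lin f := tsum_linear (tens_map_summand f) : linear (tens_map^~ f).
have map0 f : tens_map 0 f = 0.
  by have := lin f (-1) 0 0; rewrite scaler0 addr0 scaleN1r addNr.
have mapD f u v : tens_map (u + v) f = tens_map u f + tens_map v f.
  by have := lin f 1 u v; rewrite !scale1r.
move=> k f g; elim/tensor_ind: r => [|t u IHt IHu|x y].
- by rewrite !map0 scaler0 addr0.
- by rewrite !mapD IHt IHu scalerDr addrACA.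
- rewrite /tens_map !(tsum_tens (tens_map_summand _)) /pairing /=.
  by rewrite scalerDl -scalerA.
Qed.

HB.instance Definition _ r := GRing.isLinear.Build K (dual A) A *:%R
  (tens_map r) (tens_map_linear r).

Definition skew_symmetric r : Prop := forall f, tens_map r f = - tens_map_tr r f.

Definition O_operator_system (M : lmodType K) (B : bimodule A M)
    (R S : {linear M -> A}) : Prop :=
  forall x y : M,
    R x ** R y = R (lact B (R x) y + ract B x (S y)) /\
    S x ** S y = S (lact B (R x) y + ract B x (S y)).

(* (A ⊗ A) ⊗ A stands for A ⊗ A ⊗ A. *)
Definition AYB_pair r s : Prop :=
  \tsum_(r1 ⊗ r2 <- r) \tsum_(r1' ⊗ r2' <- r) ((r1 ** r1') ⊗ r2' ⊗ r2)
  - \tsum_(r1 ⊗ r2 <- r) \tsum_(r1' ⊗ r2' <- r) (r1 ⊗ (r2 ** r1') ⊗ r2')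
  + \tsum_(r1 ⊗ r2 <- r) \tsum_(s1 ⊗ s2 <- s) (r1 ⊗ s1 ⊗ (s2 ** r2)) = 0
  /\
  \tsum_(s1 ⊗ s2 <- s) \tsum_(r1 ⊗ r2 <- r) ((s1 ** r1) ⊗ r2 ⊗ s2)
  - \tsum_(s1 ⊗ s2 <- s) \tsum_(s1' ⊗ s2' <- s) (s1 ⊗ (s2 ** s1') ⊗ s2')
  + \tsum_(s1 ⊗ s2 <- s) \tsum_(s1' ⊗ s2' <- s) (s1 ⊗ s1' ⊗ (s2' ** s2)) = 0.

Definition derivation (M : lmodType K) (B : bimodule A M)
    (d : {linear A -> M}) : Prop :=
  forall a b, d (a ** b) = ract B (d a) b + lact B a (d b).

Definition coassociative (D : {linear A -> tensor A A}) : Prop :=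
  forall a,
    \tsum_(b ⊗ c <- D a) (D b ⊗ c) =
    \tsum_(b ⊗ c <- D a) \tsum_(c1 ⊗ c2 <- D c) (b ⊗ c1 ⊗ c2).

Record covariant_bialgebra (d1 d2 D : {linear A -> tensor A A}) : Prop := {
  covariant_derivation1 : derivation (tens_bimodule A) d1;
  covariant_derivation2 : derivation (tens_bimodule A) d2;
  covariant_coassociative : coassociative D;
  covariant_D1 : forall a b, D (a ** b) = tens_ract (D a) b + tens_lact a (d1 b);
  covariant_D2 : forall a b, D (a ** b) = tens_ract (d2 a) b + tens_lact a (D b)
}.

Definition coproduct r s a : A ⊗ A :=
  \tsum_(r1 ⊗ r2 <- r) ((a ** r1) ⊗ r2) - \tsum_(s1 ⊗ s2 <- s) (s1 ⊗ (s2 ** a)).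

Definition delta r a : A ⊗ A :=
  \tsum_(r1 ⊗ r2 <- r) ((a ** r1) ⊗ r2) - \tsum_(r1 ⊗ r2 <- r) (r1 ⊗ (r2 ** a)).

Fact coproduct_linear r s : linear (coproduct r s).
Proof.
move=> k a b; rewrite -[coproduct _ _ _]/(tens_lact _ r - tens_ract s _).
by rewrite linearPl linearPr opprD addrACA -scalerBr.
Qed.

Fact delta_linear r : linear (delta r).
Proof. exact: (coproduct_linear r r). Qed.

HB.instance Definition _ r s := GRing.isLinear.Build K A (tensor A A) *:%R
  (coproduct r s) (coproduct_linear r s).
HB.instance Definition _ r := GRing.isLinear.Build K A (tensor A A) *:%R
  (delta r) (delta_linear r).

Definition quasitriangular_covariant_bialgebra r s : Prop :=
  covariant_bialgebra (delta r) (delta s) (coproduct r s) /\ AYB_pair r s.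

End Definitions.

(* Main.v *)
From HB Require Import structures.
Require Import Defs.
From mathcomp Require Import all_boot all_algebra.
From mathcomp Require Import boolp classical_sets.
From mathcomp.multinomials Require freeg.

Set Implicit Arguments.
Unset Strict Implicit.
Unset Printing Implicit Defensive.

Import GRing.Theory.
Local Open Scope classical_set_scope.
Local Open Scope ring_scope.

(** The proof compares both sides of the equivalence with the associative
    Yang-Baxter pair condition, that is, with the vanishing of two elements
    E1 and E2 of A ⊗ A ⊗ A ([AYB1] and [AYB2]).

    A Yang-Baxter pair is automatically a quasitriangular covariant bialgebra.
    The derivation and compatibility identities hold for all r and s, because
    delta_r(a) = a r - r a, delta_s(a) = a s - s a and Delta(a) = a r - s a in
    the bimodule A ⊗ A; for coassociativity, a direct expansion gives
    (Delta ⊗ id) Delta(a) - (id ⊗ Delta) Delta(a) = a E1 - E2 a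
    ([coassociative_defect]), where a acts on the outer tensor factors.

    A Yang-Baxter pair is the same thing as an O-operator system.  An element X
    of A ⊗ A ⊗ A is zero as soon as all the scalars (f ⊗ g ⊗ h)(X), for f, g, h
    in the dual of A, are zero ([eval3_separates]).  Since s is skew-symmetric,
    (h ⊗ g ⊗ f)(E1) and (g ⊗ f ⊗ h)(E2) are the values of h at the defects, for
    the pair (f, g), of the equations for R and for S respectively
    ([eval3_AYB1], [eval3_AYB2]).  The second equation needs the functionals on
    the first two factors of E2: contracting the last two would produce products
    s(f) r(g) instead of s(f) s(g).

    A may be infinite-dimensional, so the separation statement rests on Zorn's
    lemma: a vector outside a subspace W lies outside some hyperplane that
    contains W ([hyperplane_functional]).  It follows by induction on the number
    of terms that a tensor killed by id ⊗ f for every functional f is zero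
    ([contract_separates]). *)

(** * Implicit sums *)

Lemma linearBD (K : fieldType) (U V : lmodType K) (p : {linear U -> V}) x y z :
  p (x - y + z) = p x - p y + p z.
Proof. by rewrite linearD linearB. Qed.

Section ImplicitSums.
Context (K : fieldType) (U V : lmodType K).

(** An implicit sum is an actual finite sum, with the same terms for every
    summand f, bilinear or not.  Hence it commutes with linear maps, sums and
    other implicit sums without any bilinearity condition. *)
Lemma tsumE (t : U ⊗ V) : exists l : seq (K * (U * V)),
  forall (W : lmodType K) (f : U -> V -> W),
    tsum f t = \sum_(z <- l) z.1 *: f z.2.1 z.2.2.
Proof.
exists (freeg.FreegDefs.seq_of_prefreeg (repr (repr t))) => W f.
by rewrite /tsum; unlock freeg.fglift.
Qed.

Lemma eq_tsum (W : lmodType K) (f g : U -> V -> W) (t : U ⊗ V) :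
  (forall x y, f x y = g x y) -> tsum f t = tsum g t.
Proof.
by have [l lE] := tsumE t => fg; rewrite !lE; apply: eq_bigr => z _; rewrite fg.
Qed.

Lemma linear_tsum (W W' : lmodType K) (p : {linear W -> W'})
    (f : U -> V -> W) (t : U ⊗ V) :
  p (tsum f t) = tsum (fun x y => p (f x y)) t.
Proof.
have [l lE] := tsumE t; rewrite !lE linear_sum.
by apply: eq_bigr => z _; rewrite linearZ.
Qed.

Lemma tsumD (W : lmodType K) (f g : U -> V -> W) (t : U ⊗ V) :
  tsum (fun x y => f x y + g x y) t = tsum f t + tsum g t.
Proof.
have [l lE] := tsumE t; rewrite !lE -big_split.
by apply: eq_bigr => z _; rewrite scalerDr.
Qed.

Lemma tsumN (W : lmodType K) (f : U -> V -> W) (t : U ⊗ V) :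
  tsum (fun x y => - f x y) t = - tsum f t.
Proof.
have [l lE] := tsumE t; rewrite !lE -sumrN.
by apply: eq_bigr => z _; rewrite scalerN.
Qed.

Lemma tsum_sum (W : lmodType K) I (l : seq I) (f : I -> U -> V -> W)
    (t : U ⊗ V) :
  tsum (fun x y => \sum_(i <- l) f i x y) t = \sum_(i <- l) tsum (f i) t.
Proof.
have [m mE] := tsumE t; rewrite mE.
under [RHS]eq_bigr do rewrite mE.
by rewrite exchange_big; apply: eq_bigr => z _; rewrite scaler_sumr.
Qed.

Lemma tsum_id (t : U ⊗ V) : tsum (fun x y => x ⊗ y) t = t.
Proof.
have lin := tsum_linear (@tens_bilinear K U V).
elim/tensor_ind: t => [|t u IHt IHu|u v].
- by have := lin (-1) 0 0; rewrite scaler0 addr0 scaleN1r addNr.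
- by have := lin 1 t u; rewrite !scale1r IHt IHu.
- exact: tsum_tens (@tens_bilinear K U V) u v.
Qed.

Lemma scaler_tsum (W : lmodType K) (k : K) (f : U -> V -> W) (t : U ⊗ V) :
  k *: tsum f t = tsum (fun x y => k *: f x y) t.
Proof.
have [l lE] := tsumE t; rewrite !lE scaler_sumr.
by apply: eq_bigr => z _; rewrite !scalerA mulrC.
Qed.

Lemma mulr_tsuml (f : U -> V -> K^o) (t : U ⊗ V) (k : K) :
  tsum f t * k = tsum (fun x y => f x y * k : K^o) t.
Proof.
have [l lE] := tsumE t; rewrite !lE mulr_suml.
by apply: eq_bigr => z _; rewrite /GRing.scale /= mulrA.
Qed.

End ImplicitSums.

Section BilinearSums.
Context (K : fieldType) (U V W : lmodType K) (b : {bilinear U -> V -> W}).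
Context (U' V' : lmodType K).

Lemma bilinear_tsuml (f : U' -> V' -> U) (t : U' ⊗ V') v :
  b (tsum f t) v = tsum (fun x y => b (f x y) v) t.
Proof. exact: linear_tsum (applyr b v) f t. Qed.

Lemma bilinear_tsumr (f : U' -> V' -> V) (t : U' ⊗ V') u :
  b u (tsum f t) = tsum (fun x y => b u (f x y)) t.
Proof. exact: linear_tsum (b u) f t. Qed.

End BilinearSums.

Lemma exchange_tsum (K : fieldType) (U V U' V' W : lmodType K)
    (f : U -> V -> U' -> V' -> W) (t : U ⊗ V) (t' : U' ⊗ V') :
  tsum (fun x y => tsum (f x y) t') t =
  tsum (fun x' y' => tsum (fun x y => f x y x' y') t) t'.
Proof.
have [m mE] := tsumE t'; rewrite mE.
under eq_tsum do rewrite mE.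
rewrite tsum_sum; apply: eq_bigr => z _; have [l lE] := tsumE t.
rewrite !lE scaler_sumr; apply: eq_bigr => y _.
by rewrite !scalerA mulrC.
Qed.

(** * Linear functionals separate points *)

Section Separation.
Context (K : fieldType).

Section Functionals.
Context (V : lmodType K).

(** Closure under linear combinations; the empty set is allowed. *)
Definition lin_closed (H : set V) : Prop :=
  forall k x y, H x -> H y -> H (k *: x + y).

(** With [W 0], the hypothesis on [W] says that it is a subspace.  A maximal
    subspace containing W but not v is a hyperplane H, and f x is the scalar k
    such that x - k v lies in H. *)
Lemma hyperplane_functional (W : set V) (v : V) :
  W 0 -> lin_closed W -> ~ W v ->
  exists f : dual V, f v = 1 /\ forall w, W w -> f w = 0.
Proof.
move=> W0 Wlin Wv.
(* The subspace that grows is the union of W and X; for the empty chain it is W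
   itself. *)
pose P (X : set V) := lin_closed (W `|` X) /\ ~ (W `|` X) v.
have [|M [[Hlin Hv] Mmax]] := @Zorn_bigcup V P.
  move=> F FP Ftot; split.
    move=> k x y [Wx|[X FX Xx]] [Wy|[Y FY Yy]].
    - by left; apply: Wlin.
    - have [?|?] := (FP _ FY).1 k x y (or_introl Wx) (or_intror Yy); first by left.
      by right; exists Y.
    - have [?|?] := (FP _ FX).1 k x y (or_intror Xx) (or_introl Wy); first by left.
      by right; exists X.
    - have [Z FZ [Zx Zy]] : exists2 Z, F Z & Z x /\ Z y.
        have [XY|YX] := Ftot _ _ FX FY.
          by exists Y => //; split=> //; apply: XY.
        by exists X => //; split=> //; apply: YX.
      have [?|?] := (FP _ FZ).1 k x y (or_intror Zx) (or_intror Zy); first by left.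
      by right; exists Z.
  by move=> [//|[X FX Xv]]; apply: (FP _ FX).2; right.
set H := W `|` M in Hlin Hv.
have H0 : H 0 by left.
have HZ k x : H x -> H (k *: x) by move=> Hx; rewrite -[_ *: _]addr0; apply: Hlin.
have HD x y : H x -> H y -> H (x + y) by rewrite -{2}[x]scale1r; apply: Hlin.
(* By maximality, H and v span V. *)
have span x : exists k, H (x - k *: v).
  have [Hx|Hx] := pselect (H x); first by exists 0; rewrite scale0r subr0.
  pose B : set V := [set z | exists k, H (z - k *: x)].
  have HB z : H z -> B z by exists 0; rewrite scale0r subr0.
  have [k Hk] : B v.
    apply: contrapT => Bv; apply: (Mmax B).
      split; first by move=> z Mz; apply: HB; right.
      by move=> BM; apply: Hx; right; apply: BM; exists 1; rewrite scale1r subrr.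
    have WB : W `|` B = B by apply/setUidPr => z Wz; apply: HB; left.
    split; rewrite WB // => k y z [l Hl] [m Hm]; exists (k * l + m).
    rewrite scalerDl opprD addrACA -scalerA -scalerBr.
    exact: Hlin.
  have k0 : k != 0.
    by apply: contra_notN Hv => /eqP k0; move: Hk; rewrite k0 scale0r subr0.
  exists k^-1; have -> : x - k^-1 *: v = (- k^-1) *: (v - k *: x).
    by rewrite scalerBr scalerA mulNr mulVf // !scaleNr scale1r opprK addrC.
  exact: HZ.
pose c x := sval (cid (span x)).
have cP x : H (x - c x *: v) by exact: svalP (cid (span x)).
have cE x k : H (x - k *: v) -> c x = k.
  move=> Hk; apply/eqP/contraT => ck; case: Hv.
  have d0 : k - c x != 0 by rewrite subr_eq0 eq_sym.
  rewrite -[v]scale1r -(mulVf d0) -scalerA; apply: (HZ).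
  have -> : (k - c x) *: v = (x - c x *: v) + (-1) *: (x - k *: v).
    by rewrite scaleN1r opprB [RHS]addrC addrA subrK scalerBl.
  by apply: HD => //; apply: HZ.
have c_lin : linear (c : V -> K^o).
  move=> k x y; apply: cE; rewrite scalerDl opprD addrACA -scalerA -scalerBr.
  exact: Hlin.
pose cL := GRing.isLinear.Build K V K^o *:%R (c : V -> K^o) c_lin.
pose f : {linear V -> K^o} := HB.pack (c : V -> K^o) cL.
exists f; split; first by apply: cE; rewrite scale1r subrr.
by move=> w Ww; apply: cE; rewrite scale0r subr0; left.
Qed.

Lemma dual_separates (v : V) : (forall f : dual V, f v = 0) -> v = 0.
Proof.
move=> fv; apply: contrapT => v0.
have [||f [f1 _]] := @hyperplane_functional [set 0] v _ _ v0.
- by [].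
- by move=> k x y /= -> ->; rewrite scaler0 addr0.
- by move/eqP: f1; rewrite fv eq_sym oner_eq0.
Qed.

End Functionals.

Section Contraction.
Context (U V : lmodType K) (f : dual V).

(** The contraction id ⊗ f : U ⊗ V -> U. *)
Definition contract (t : U ⊗ V) : U := \tsum_(x ⊗ y <- t) (f y *: x).

Lemma contract_bilinear : is_bilinear (fun x y => f y *: x : U).
Proof.
split=> [y k x x'|x k y y'] /=.
- by rewrite scalerDr !scalerA mulrC.
- by rewrite linearP scalerDl -scalerA.
Qed.

HB.instance Definition _ :=
  GRing.isLinear.Build K (tensor U V) U *:%R contract
    (tsum_linear contract_bilinear).

Lemma contract_tens u v : contract (u ⊗ v) = f v *: u.
Proof. exact: tsum_tens contract_bilinear u v. Qed.

End Contraction.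

(** Induction on the number of terms u_i ⊗ v_i of t: if v_0 is a combination of
    the other v_i, then t has a shorter expression; otherwise some functional is
    1 at v_0 and 0 at the other v_i, so that u_0 = 0. *)
Lemma contract_separates (U V : lmodType K) (t : U ⊗ V) :
  (forall f : dual V, contract f t = 0) -> t = 0.
Proof.
have [n [u [v ->]]] : exists n (u : 'I_n -> U) (v : 'I_n -> V),
    t = \sum_(i < n) u i ⊗ v i.
  have [l lE] := tsumE t; pose z0 : K * (U * V) := (0, (0, 0)).
  exists (size l), (fun i => (nth z0 l i).1 *: (nth z0 l i).2.1),
    (fun i => (nth z0 l i).2.2).
  rewrite -{1}[t]tsum_id lE (big_nth z0) big_mkord.
  by apply: eq_bigr => i _; rewrite linearZl_LR.
elim: n => [|n IHn] in u v *; first by rewrite big_ord0.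
pose v' i := v (lift ord0 i).
have [[c v0]|v0] := pselect (exists c : 'I_n -> K, v ord0 = \sum_i c i *: v' i).
  have -> : \sum_i u i ⊗ v i =
      \sum_(i < n) (c i *: u ord0 + u (lift ord0 i)) ⊗ v' i.
    rewrite big_ord_recl v0 linear_sumr -big_split; apply: eq_bigr => i _ /=.
    by rewrite linearDl linearZl_LR linearZr.
  exact: IHn.
move=> ft.
have [||f [f1 f0]] := @hyperplane_functional V
    [set x | exists c : 'I_n -> K, x = \sum_i c i *: v' i] (v ord0) _ _ v0.
- by exists (fun _ => 0); rewrite big1 // => i _; rewrite scale0r.
- move=> k x y [c ->] [d ->]; exists (fun i => k * c i + d i).
  rewrite scaler_sumr -big_split; apply: eq_bigr => i _.
  by rewrite /= scalerDl scalerA.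
have u0 : u ord0 = 0.
  have := ft f; rewrite linear_sum big_ord_recl /= contract_tens f1 scale1r.
  rewrite big1 ?addr0 // => i _; rewrite contract_tens f0 ?scale0r //.
  exists (fun j => (i == j)%:R); rewrite (bigD1 i) //= eqxx scale1r.
  by rewrite big1 ?addr0 // => j /negPf ji; rewrite eq_sym ji scale0r.
move: ft; rewrite big_ord_recl u0 linear0l add0r; exact: IHn.
Qed.

End Separation.

(** * Yang-Baxter pairs and O-operators *)

Section YangBaxter.
Context (K : fieldType) (A : assocAlgType K).
Implicit Types (f g h : dual A) (r s : A ⊗ A).

(** The linear form f ⊗ g ⊗ h on A ⊗ A ⊗ A. *)
Definition eval3 f g h (X : (A ⊗ A ⊗ A)%type) : K^o :=
  f (contract g (contract h X)).

Lemma eval3_linear f g h : linear (eval3 f g h).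
Proof. by move=> k X Y; rewrite /eval3 !linearP. Qed.

HB.instance Definition _ f g h :=
  GRing.isLinear.Build K (tensor (tensor A A) A) K^o *:%R (eval3 f g h)
    (eval3_linear f g h).

Lemma eval3_tens f g h x y z : eval3 f g h (x ⊗ y ⊗ z) = h z * (g y * f x).
Proof.
by rewrite /eval3 contract_tens [contract g _]linearZ /= contract_tens !linearZ.
Qed.

Lemma eval3_tsum2 f g h (F : A -> A -> A -> A -> (A ⊗ A ⊗ A)%type) r s :
  eval3 f g h (\tsum_(x ⊗ y <- r) \tsum_(x' ⊗ y' <- s) F x y x' y') =
  \tsum_(x ⊗ y <- r) \tsum_(x' ⊗ y' <- s) eval3 f g h (F x y x' y').
Proof. by rewrite linear_tsum; apply: eq_tsum => x y; rewrite linear_tsum. Qed.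

Lemma eval3_separates (X : (A ⊗ A ⊗ A)%type) :
  (forall f g h, eval3 f g h X = 0) -> X = 0.
Proof.
move=> X0; apply: contract_separates => h; apply: contract_separates => g.
by apply: dual_separates => f; apply: X0.
Qed.

Lemma dual_tens_map h r f :
  h (tens_map r f) = \tsum_(x ⊗ y <- r) (f y * h x) :> K^o.
Proof. by rewrite linear_tsum; apply: eq_tsum => x y; rewrite linearZ. Qed.

Lemma dual_tens_map_tr h r f :
  h (tens_map_tr r f) = \tsum_(x ⊗ y <- r) (f x * h y) :> K^o.
Proof. by rewrite linear_tsum; apply: eq_tsum => x y; rewrite linearZ. Qed.

Lemma dual_lactE (a : A) f x : dual_lact a f x = f (x ** a).
Proof. by []. Qed.

Lemma dual_ractE (a : A) f x : dual_ract f a x = f (a ** x).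
Proof. by []. Qed.

(** The left-hand sides E1 and E2 of the two equations that define an
    associative Yang-Baxter pair. *)
Definition AYB1 r s : (A ⊗ A ⊗ A)%type :=
  \tsum_(r1 ⊗ r2 <- r) \tsum_(r1' ⊗ r2' <- r) ((r1 ** r1') ⊗ r2' ⊗ r2)
  - \tsum_(r1 ⊗ r2 <- r) \tsum_(r1' ⊗ r2' <- r) (r1 ⊗ (r2 ** r1') ⊗ r2')
  + \tsum_(r1 ⊗ r2 <- r) \tsum_(s1 ⊗ s2 <- s) (r1 ⊗ s1 ⊗ (s2 ** r2)).

Definition AYB2 r s : (A ⊗ A ⊗ A)%type :=
  \tsum_(s1 ⊗ s2 <- s) \tsum_(r1 ⊗ r2 <- r) ((s1 ** r1) ⊗ r2 ⊗ s2)
  - \tsum_(s1 ⊗ s2 <- s) \tsum_(s1' ⊗ s2' <- s) (s1 ⊗ (s2 ** s1') ⊗ s2')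
  + \tsum_(s1 ⊗ s2 <- s) \tsum_(s1' ⊗ s2' <- s) (s1 ⊗ s1' ⊗ (s2' ** s2)).

(** E1 measures the failure of r(f) r(g) = r(r(f) g + f s(g)).  The first two
    terms match for all r and s; skewness of s turns the form
    f(s(g) _) into - f(s^t(g) _), the one that appears in the last term. *)
Lemma eval3_AYB1 r s f g h : skew_symmetric s ->
  eval3 h g f (AYB1 r s) =
  h (tens_map r f ** tens_map r g -
     tens_map r (dual_lact (tens_map r f) g + dual_ract f (tens_map s g))).
Proof.
move=> skew_s; rewrite /AYB1 (linearBD (eval3 _ _ _)) /= !eval3_tsum2.
rewrite (linearD (tens_map r)) linearB linearD opprD addrA; congr (_ - _ + _).
- rewrite [tens_map r f]/tens_map (bilinear_tsuml (@amul K A)) linear_tsum.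
  apply: eq_tsum => x y; rewrite (bilinear_tsumr (@amul K A)) linear_tsum.
  apply: eq_tsum => x' y'; rewrite eval3_tens.
  by rewrite linearZl_LR linearZr /= !linearZ.
- rewrite dual_tens_map; apply: eq_tsum => x y.
  rewrite dual_lactE (bilinear_tsumr (@amul K A)) linear_tsum.
  rewrite mulr_tsuml; apply: eq_tsum => x' y'.
  by rewrite eval3_tens linearZr linearZ /= mulrA.
- rewrite dual_tens_map -tsumN; apply: eq_tsum => x y.
  rewrite dual_ractE skew_s linearNl linearN mulNr opprK.
  rewrite (bilinear_tsuml (@amul K A)) linear_tsum mulr_tsuml.
  apply: eq_tsum => x' y'.
  by rewrite eval3_tens linearZl_LR linearZ /= mulrCA mulrA.
Qed.

(** E2 measures the failure of s(f) s(g) = s(r(f) g + f s(g)).  The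
    functionals f and g act on the first two factors of E2, where
    s^t(f) = <f, s1> s2 = - s(f) is what occurs. *)
Lemma eval3_AYB2 r s f g h : skew_symmetric s ->
  eval3 g f h (AYB2 r s) =
  h (tens_map s f ** tens_map s g -
     tens_map s (dual_lact (tens_map r f) g + dual_ract f (tens_map s g))).
Proof.
move=> skew_s; rewrite /AYB2 (linearBD (eval3 _ _ _)) /= !eval3_tsum2.
rewrite (linearD (tens_map s)) linearB linearD opprD [LHS]addrC !addrA; congr (_ + _ + _).
- rewrite skew_s [in RHS]skew_s linearNl linearNr opprK.
  rewrite [tens_map_tr s f]/tens_map_tr (bilinear_tsuml (@amul K A)) linear_tsum.
  rewrite exchange_tsum; apply: eq_tsum => x' y'.
  rewrite (bilinear_tsumr (@amul K A)) linear_tsum.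
  apply: eq_tsum => x y; rewrite eval3_tens.
  by rewrite linearZl_LR linearZr /= !linearZ /= mulrC -mulrA.
- rewrite /= skew_s linearN opprK dual_tens_map_tr; apply: eq_tsum => x y.
  rewrite dual_lactE (bilinear_tsumr (@amul K A)) linear_tsum.
  rewrite mulr_tsuml; apply: eq_tsum => x' y'.
  by rewrite eval3_tens linearZr linearZ /= mulrC.
- rewrite /= skew_s linearN opprK dual_tens_map_tr exchange_tsum -tsumN.
  apply: eq_tsum => x' y'.
  rewrite dual_ractE skew_s linearNl linearN mulNr.
  rewrite (bilinear_tsuml (@amul K A)) (linear_tsum f) mulr_tsuml.
  congr (- _); apply: eq_tsum => x y.
  by rewrite eval3_tens linearZl_LR linearZ /= mulrC [_ * g x]mulrC.
Qed.

Lemma AYB_pairE r s : AYB_pair r s <-> AYB1 r s = 0 /\ AYB2 r s = 0.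
Proof. by []. Qed.

Lemma AYB_pair_O_operator r s : skew_symmetric s ->
  AYB_pair r s <->
  O_operator_system (dual_bimodule A) (tens_map r) (tens_map s).
Proof.
move=> skew_s; split.
  move=> /AYB_pairE[E1 E2] f g.
  split; apply/eqP; rewrite -subr_eq0; apply/eqP/dual_separates => h.
  - by rewrite -eval3_AYB1 // E1 linear0.
  - by rewrite -eval3_AYB2 // E2 linear0.
move=> op; apply/AYB_pairE; split; apply: eval3_separates => f g h.
- by rewrite eval3_AYB1 // (op h g).1 subrr linear0.
- by rewrite eval3_AYB2 // (op g f).2 subrr linear0.
Qed.

End YangBaxter.

(** * Covariant bialgebras *)

Section CovariantBialgebra.
Context (K : fieldType) (A : assocAlgType K).
Implicit Types (a b : A) (r s : A ⊗ A).

Lemma covariant_coproductl r s a b :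
  coproduct r s (a ** b) =
  tens_ract (coproduct r s a) b + tens_lact a (delta r b).
Proof.
rewrite -[coproduct r s _]/(tens_lact _ r - tens_ract s _).
rewrite -[coproduct r s a]/(tens_lact _ r - tens_ract s _).
rewrite -[delta r b]/(tens_lact _ r - tens_ract r _).
rewrite linearBl linearBr /= tens_lactA tens_ractA tens_lractA.
by rewrite [RHS]addrC addrA subrK.
Qed.

Lemma covariant_coproductr r s a b :
  coproduct r s (a ** b) =
  tens_ract (delta s a) b + tens_lact a (coproduct r s b).
Proof.
rewrite -[coproduct r s (a ** b)]/(tens_lact _ r - tens_ract s _).
rewrite -[coproduct r s b]/(tens_lact _ r - tens_ract s _).
rewrite -[delta s a]/(tens_lact _ s - tens_ract s _).
rewrite linearBl linearBr /= tens_lactA tens_ractA tens_lractA.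
by rewrite [RHS]addrC addrA subrK.
Qed.

Lemma delta_derivation r : derivation (tens_bimodule A) (delta r).
Proof. exact: covariant_coproductl. Qed.

Lemma tsum_coproduct (W : lmodType K) (F : A -> A -> W) r s a :
  is_bilinear F ->
  tsum F (coproduct r s a) =
  \tsum_(x ⊗ y <- r) F (a ** x) y - \tsum_(x ⊗ y <- s) F x (y ** a).
Proof.
move=> F_bilin.
pose pL := GRing.isLinear.Build K (A ⊗ A)%type W *:%R (tsum F) (tsum_linear F_bilin).
pose p : {linear (A ⊗ A)%type -> W} := HB.pack (tsum F) pL.
rewrite -[LHS]/(p _) linearB !(linear_tsum p).
by congr (_ - _); apply: eq_tsum => x y; apply: (tsum_tens F_bilin).
Qed.

(** The outer bimodule structure of A ⊗ A ⊗ A: left multiplication of the first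
    factor and right multiplication of the last one. *)
Definition tens_lact3 a (X : (A ⊗ A ⊗ A)%type) : (A ⊗ A ⊗ A)%type :=
  \tsum_(t ⊗ z <- X) (tens_lact a t ⊗ z).

Definition tens_ract3 a (X : (A ⊗ A ⊗ A)%type) : (A ⊗ A ⊗ A)%type :=
  \tsum_(t ⊗ z <- X) (t ⊗ (z ** a)).

Lemma tens_lact3_summand a :
  is_bilinear (fun t z => tens_lact a t ⊗ z : (A ⊗ A ⊗ A)%type).
Proof.
by split=> [z k t t'|t k z z'] /=; rewrite !(linearPr, linearPl).
Qed.

Lemma tens_ract3_summand a :
  is_bilinear (fun t z => t ⊗ (z ** a) : (A ⊗ A ⊗ A)%type).
Proof.
by split=> [z k t t'|t k z z'] /=; rewrite !(linearPr, linearPl).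
Qed.

HB.instance Definition _ a :=
  GRing.isLinear.Build K (tensor (tensor A A) A) (tensor (tensor A A) A) *:%R
    (tens_lact3 a) (tsum_linear (tens_lact3_summand a)).

HB.instance Definition _ a :=
  GRing.isLinear.Build K (tensor (tensor A A) A) (tensor (tensor A A) A) *:%R
    (tens_ract3 a) (tsum_linear (tens_ract3_summand a)).

Lemma tens_lact3_tens a x y z :
  tens_lact3 a (x ⊗ y ⊗ z) = (a ** x) ⊗ y ⊗ z.
Proof. by rewrite /tens_lact3 (tsum_tens (tens_lact3_summand a)) tens_lact_tens. Qed.

Lemma tens_ract3_tens a x y z :
  tens_ract3 a (x ⊗ y ⊗ z) = x ⊗ y ⊗ (z ** a).
Proof. by rewrite /tens_ract3 (tsum_tens (tens_ract3_summand a)). Qed.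

Lemma coproduct_left_summand (D : {linear A -> tensor A A}) :
  is_bilinear (fun b c : A => D b ⊗ c).
Proof. by split=> [z k t t'|t k z z'] /=; rewrite ?linearP !(linearPr, linearPl). Qed.

Lemma assoc_summand a :
  is_bilinear (fun b c => a ⊗ b ⊗ c : (A ⊗ A ⊗ A)%type).
Proof. by split=> [z k t t'|t k z z'] /=; rewrite !(linearPr, linearPl). Qed.

Lemma coproduct_right_summand (D : {linear A -> tensor A A}) :
  is_bilinear (fun b c : A => \tsum_(c1 ⊗ c2 <- D c) (b ⊗ c1 ⊗ c2)).
Proof.
split=> [c k b b'|b k c c'] /=; last first.
  by rewrite linearP; apply: (tsum_linear (assoc_summand b)).
rewrite scaler_tsum -tsumD; apply: eq_tsum => x y.
by rewrite linearPl /= linearPl.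
Qed.

Lemma tsum2_comp (p : {linear (A ⊗ A ⊗ A)%type -> (A ⊗ A ⊗ A)%type}) r s
    (F : A -> A -> A -> A -> (A ⊗ A ⊗ A)%type) :
  p (\tsum_(x ⊗ y <- r) \tsum_(x' ⊗ y' <- s) F x y x' y') =
  \tsum_(x ⊗ y <- r) \tsum_(x' ⊗ y' <- s) p (F x y x' y').
Proof. by rewrite linear_tsum; apply: eq_tsum => x y; rewrite linear_tsum. Qed.

Lemma coproduct_tens r s a b :
  coproduct r s a ⊗ b =
  \tsum_(x ⊗ y <- r) ((a ** x) ⊗ y ⊗ b) -
  \tsum_(x ⊗ y <- s) (x ⊗ (y ** a) ⊗ b).
Proof.
rewrite /coproduct linearBl /=.
by rewrite !(bilinear_tsuml (@tens K (A ⊗ A)%type A)).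
Qed.

(** No hypothesis on r and s is needed for this expansion; the terms
    s1 ⊗ (s2 a r1) ⊗ r2 occur on both sides of coassociativity and cancel. *)
Lemma coassociative_defect r s a :
  \tsum_(b ⊗ c <- coproduct r s a) (coproduct r s b ⊗ c) -
  \tsum_(b ⊗ c <- coproduct r s a)
    \tsum_(c1 ⊗ c2 <- coproduct r s c) (b ⊗ c1 ⊗ c2) =
  tens_lact3 a (AYB1 r s) - tens_ract3 a (AYB2 r s).
Proof.
rewrite (tsum_coproduct _ _ _ (coproduct_left_summand _)).
rewrite (tsum_coproduct _ _ _ (coproduct_right_summand _)).
rewrite (linearBD (tens_lact3 a)) (linearBD (tens_ract3 a)).
rewrite !(tsum2_comp (tens_lact3 a)) !(tsum2_comp (tens_ract3 a)).
set X1 := (X in X - _ + _ - _); set X2 := (X in _ - X + _ - _).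
set X3 := (X in _ + X - _); set Y1 := (X in _ - (X - _ + _)).
set Y2 := (X in _ - (_ - X + _)); set Y3 := (X in _ - (_ + X)).
(* The common terms of both iterated coproducts. *)
pose Z := \tsum_(x ⊗ y <- r) \tsum_(x' ⊗ y' <- s) (x' ⊗ (y' ** (a ** x)) ⊗ y).
have -> : \tsum_(x ⊗ y <- r) (coproduct r s (a ** x) ⊗ y) = X1 - Z.
  rewrite -tsumN -tsumD; apply: eq_tsum => x y; rewrite coproduct_tens.
  congr (_ - _); apply: eq_tsum => x' y'.
  by rewrite /= tens_lact3_tens amulA.
have -> : \tsum_(x ⊗ y <- s) (coproduct r s x ⊗ (y ** a)) = Y1 - Y2.
  rewrite [Y2]exchange_tsum -tsumN -tsumD; apply: eq_tsum => x y.
  rewrite coproduct_tens.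
  by congr (_ - _); apply: eq_tsum => x' y'; rewrite /= tens_ract3_tens.
have -> : \tsum_(x ⊗ y <- r) \tsum_(x' ⊗ y' <- coproduct r s y)
    ((a ** x) ⊗ x' ⊗ y') = X2 - X3.
  rewrite -tsumN -tsumD; apply: eq_tsum => x y.
  rewrite (tsum_coproduct _ _ _ (assoc_summand _)).
  by congr (_ - _); apply: eq_tsum => x' y'; rewrite /= tens_lact3_tens.
have -> : \tsum_(x ⊗ y <- s) \tsum_(x' ⊗ y' <- coproduct r s (y ** a))
    (x ⊗ x' ⊗ y') = Z - Y3.
  rewrite [Z]exchange_tsum -tsumN -tsumD; apply: eq_tsum => x y.
  rewrite (tsum_coproduct _ _ _ (assoc_summand _)).
  congr (_ - _); apply: eq_tsum => x' y'; first by rewrite amulA.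
  by rewrite /= tens_ract3_tens amulA.
rewrite !opprB opprD opprB addrACA [X1 - Z + _]addrA subrK.
rewrite [Y2 - Y1 + _]addrC addrACA -[X1 - X2 + X3]addrA.
by rewrite [- X2 + X3]addrC [- Y3 + _]addrC.
Qed.

Lemma AYB_coassociative r s : AYB_pair r s -> coassociative (coproduct r s).
Proof.
move=> /AYB_pairE[E1 E2] a; apply/eqP; rewrite -subr_eq0 coassociative_defect.
by rewrite E1 E2 (linear0 (tens_lact3 a)) (linear0 (tens_ract3 a)) subrr.
Qed.

Lemma quasitriangular_AYB r s :
  quasitriangular_covariant_bialgebra r s <-> AYB_pair r s.
Proof.
split=> [[]//|ayb]; split=> //; split.
- exact: delta_derivation.
- exact: delta_derivation.
- exact: AYB_coassociative.
- exact: covariant_coproductl.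
- exact: covariant_coproductr.
Qed.

End CovariantBialgebra.

Theorem corollary4p3 (K : fieldType) (A : assocAlgType K) (r s : (A ⊗ A)%type) :
  skew_symmetric r -> skew_symmetric s ->
  (O_operator_system (dual_bimodule A) (tens_map r) (tens_map s) <->
   quasitriangular_covariant_bialgebra r s).
Proof.
move=> _ skew_s; rewrite quasitriangular_AYB; apply: iff_sym.
exact: AYB_pair_O_operator.
Qed.
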